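(* Let $k$ be a field of characteristic $0$, let $m,n\ge 1$ be integers, and let $x_{ij}$ ($1\le i\le m$, $1\le j\le n$) be independent variables over $k$. (1) Every rational function $f\in k(x_{ij})$ in the $mn$ variables $x_{ij}$ satisfying the invariance properties (a), (b), (c) given in the context can be expressed as a rational function, with coefficients in $k$, of the observables $q_{r_1,\dots,r_m}$, $(r_1,\dots,r_m)\in\mathbb{Z}^m$. In particular, $E_m$ can be expressed as a rational function of the observables $q_{r_1,\dots,r_m}$ for any $m\ge 1$. (2) Suppose $n\ge 4$. Then $E_m$ is not a polynomial (with coefficients in $k$) in the observables $q_{r_1,\dots,r_m}$, $(r_1,\dots,r_m)\in\mathbb{Z}^m$, for any $m\ge 2$.
   Context: For $(r_1,\dots,r_m)\in\mathbb{Z}^m$, the observable $q_{r_1,\dots,r_m}$ is $$q_{r_1,\dots,r_m}:=\sum_{i,j=1}^n \frac{x_{1i}^{r_1}\cdots x_{mi}^{r_m}}{x_{1j}^{r_1}\cdots x_{mj}^{r_m}}\in k(x_{ij}).$$ The function $E_m$ is $$E_m:=\sum_{j,j_1,\dots,j_m=1}^n\left(\frac{x_{1j_1}x_{2j_2}\cdots x_{mj_m}}{x_{1j}\cdots x_{mj}}+\frac{x_{1j}\cdots x_{mj}}{x_{1j_1}x_{2j_2}\cdots x_{mj_m}}\right).$$ Write $X_i=(x_{i1},\dots,x_{in})$ for $1\le i\le m$. The invariance properties of a rational function $f$ are: (a) $f$ is of weight $0$ in each array $X_i$: $f(c_1X_1,\dots,c_mX_m)=f(X_1,\dots,X_m)$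 for all nonzero scalars $c_1,\dots,c_m\in k$. (b) $f$ is self-reciprocal: it is unchanged if every variable $x_{ij}$ is simultaneously replaced by $x_{ij}^{-1}$. (c) $f$ is multi-symmetric: for every permutation $\sigma$ of $\{1,\dots,n\}$, $f$ is unchanged if every $x_{ij}$ is simultaneously replaced by $x_{i\sigma(j)}$. *)

(* Defs.v *)
From HB Require Import structures.
From mathcomp Require Import all_boot perm all_algebra.
From mathcomp Require Import generic_quotient fraction.
From mathcomp Require Export mpoly.

Set Implicit Arguments.
Unset Strict Implicit.
Unset Printing Implicit Defensive.

Import GRing.Theory.
Local Open Scope ring_scope.

(* The field k(x_ij), i < m, j < n.  The variable x_ij is the indeterminate of
   {mpoly k[m * n]} of index [mxvec_index i j]. *)
Definition ratfun (k : fieldType) (m n : nat) := {fraction {mpoly k[m * n]}}.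

Section RationalFunctions.
Variables (k : fieldType) (m n : nat).
Local Notation K := (ratfun k m n).

Definition ratC (c : k) : K := tofrac c%:MP.
HB.instance Definition _ :=
  GRing.RMorphism.copy ratC (@tofrac _ \o @mpolyC (m * n) k).

Definition xvar (i : 'I_m) (j : 'I_n) : K := tofrac 'X_(mxvec_index i j).

Definition polyval (N : nat) (v : 'I_N -> K) (P : {mpoly k[N]}) : K :=
  mmap ratC v P.

(* Substitution of V i j for x_ij in f.  It uses the representative of f chosen
   by [repr] and hence is only meaningful when P |-> P(V) does not vanish on
   nonzero polynomials.  This is the case for every substitution below: each is
   induced by an automorphism of k(x_ij). *)
Definition ratsubst (V : 'M[K]_(m, n)) (f : K) : K :=
  let v t := mxvec V ord0 t in
  polyval v (\n_(repr f)) / polyval v (\d_(repr f)).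

Definition weight0 (f : K) : Prop :=
  forall c : 'I_m -> k, (forall i, c i != 0) ->
    ratsubst (\matrix_(i, j) (ratC (c i) * xvar i j)) f = f.

Definition self_reciprocal (f : K) : Prop :=
  ratsubst (\matrix_(i, j) (xvar i j)^-1) f = f.

Definition multisymmetric (f : K) : Prop :=
  forall s : {perm 'I_n}, ratsubst (\matrix_(i, j) xvar i (s j)) f = f.

Definition observable (r : 'I_m -> int) : K :=
  \sum_(i < n) \sum_(j < n)
    (\prod_(l < m) xvar l i ^ r l) / (\prod_(l < m) xvar l j ^ r l).

Definition Efun : K :=
  \sum_(j < n) \sum_(js : {ffun 'I_m -> 'I_n})
    ((\prod_(l < m) xvar l (js l)) / (\prod_(l < m) xvar l j)
     + (\prod_(l < m) xvar l j) / (\prod_(l < m) xvar l (js l))).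

Definition rational_in_observables (f : K) : Prop :=
  exists (N : nat) (r : 'I_N -> 'I_m -> int) (P Q : {mpoly k[N]}),
    let q t := observable (r t) in
    polyval q Q != 0 /\ f = polyval q P / polyval q Q.

Definition polynomial_in_observables (f : K) : Prop :=
  exists (N : nat) (r : 'I_N -> 'I_m -> int) (P : {mpoly k[N]}),
    f = polyval (fun t => observable (r t)) P.

End RationalFunctions.

Arguments Efun k m n : clear implicits.

(* Main.v *)
From HB Require Import structures.
Require Import Defs.
From mathcomp Require Import all_boot all_order perm all_algebra fieldext.
From mathcomp Require Import generic_quotient fraction zify ring.
From Stdlib Require Import Classical.

(** Write w_j = (x_1j, ..., x_mj) for the n columns of variables, regarded as
    points of an m-dimensional torus.

    Rationality.  The observables are the power sums q_r = sum_a v_a^r of the n^2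
    points v_ij = w_i / w_j.  An automorphism fixing all of them permutes the
    points v_ij and respects the relations v_ij v_jk = v_ik.  In additive notation
    the v_ij are the roots e_i - e_j of type A_(n-1), and a permutation of roots
    respecting these relations comes from a permutation of the indices, up to a
    global sign.  So the field of the observables should be the field of
    invariants of torus, S_n and inversion.

    The proof replaces Galois theory by sums over all maps tau from the set of
    pairs (i, j) to itself.  The sum over tau of a monomial in the points
    v_(tau a) factors into observables, hence any Laurent expression h(tau) in
    these points has its total sum in the field L of rational functions of the
    observables ([laurent_total_sum]).  By Newton's identities the polynomial
    whose roots are the nonzero values of h has coefficients in L
    ([root_poly_coef_psum]), so that the indicator function of the zeros of h is
    again a Laurent expression over L ([laurent_zero_indicator]).  Therefore sums
    may be restricted to the maps tau that respect the relations between the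
    points.  Among these the maps that send no off-diagonal pair to the diagonal
    come from a symmetry g, by the combinatorics of roots ([root_star],
    [consistent_symmetry]).  If f = p / q is invariant, then p = f q at the point
    attached to such a tau, hence
      f = (sum_tau p q^(s-1)) / (sum_tau q^s),
    for an exponent s at which the denominator does not vanish; s exists because
    the power sums of nonzero elements are not all zero ([psum_neq0]).

    Non-polynomiality.  If E_m were a polynomial in the observables, then two
    numerical configurations of n nonzero points with the same observables would
    give E_m the same value ([polynomial_no_separation]).  With N = n - 2 >= 2,
    choose z with z^N = -1 and z^2 <> 1 in an extension of k.  Along a
    one-parameter subgroup take the N points z^0, z^2, ..., z^(2N-2) together with
    the points b, b z for one configuration and b z, b z^2 for the other.  Let x be
    the value of a character at the generator.  The first block has power sum 0
    unless x^2 = 1, and the second has power sum 0 if x = -1; passing to the other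
    configuration multiplies the second block by x.  So the power sum of each
    character is either unchanged or multiplied by x, and then that of the inverse
    character is multiplied by x^-1: the observables agree ([homometric]).  But E_m
    is a sum of products of three or more such power sums; it changes sign and does
    not vanish for a suitable subgroup and suitable b ([config_separates]). *)

Set Implicit Arguments.
Unset Strict Implicit.
Unset Printing Implicit Defensive.

Import GRing.Theory.
Local Open Scope ring_scope.

(** * Zariski density and Newton identities in characteristic 0 *)

Lemma rmorph_mmap N (R : nzRingType) (S S' : comNzRingType)
    (f : {rmorphism R -> S}) (g : {rmorphism S -> S'}) (f' : {rmorphism R -> S'})
    (h : 'I_N -> S) (h' : 'I_N -> S') (p : {mpoly R[N]}) :
    (forall c, f' c = g (f c)) -> (forall t, h' t = g (h t)) ->
  g (mmap f h p) = mmap f' h' p.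
Proof.
move=> Ef Eh; rewrite /mmap rmorph_sum; apply: eq_bigr => u _.
rewrite rmorphM -Ef; congr (_ * _).
by rewrite /mmap1 rmorph_prod; apply: eq_bigr => i _; rewrite rmorphXn -Eh.
Qed.

Lemma natr_neq0 (k : fieldType) : [pchar k] =i pred0 ->
  forall j : nat, (0 < j)%N -> j%:R != 0 :> k.
Proof. by move=> /(pcharf0P k) hk j; rewrite lt0n hk. Qed.

Lemma natr_inj (k : fieldType) : [pchar k] =i pred0 ->
  injective (fun j : nat => j%:R : k).
Proof.
move=> hk; have wl i j : (i <= j)%N -> i%:R = j%:R :> k -> i = j.
  move=> le_ij E; apply/eqP; rewrite eqn_leq le_ij andTb -subn_eq0.
  by move/(pcharf0P k): hk => <-; rewrite natrB // E subrr eqxx.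
by move=> i j E; case/orP: (leq_total i j) => le; [|symmetry]; apply: wl.
Qed.

Section Density.
Variables (k K : fieldType) (io : {rmorphism k -> K}).
Hypothesis hk : [pchar k] =i pred0.

(** The positive integers give infinitely many nonzero elements of k. *)
Lemma poly_vanish_dense (P : {poly K}) :
  (forall c : k, c != 0 -> P.[io c] = 0) -> P = 0.
Proof.
move=> P0; apply/eqP; apply: contraT => nzP.
pose rs := [seq io j.+1%:R | j <- iota 0 (size P)].
have := max_poly_roots (rs := rs) nzP; rewrite size_map size_iota ltnn; apply.
  apply/allP => _ /mapP [j _ ->]; apply/rootP/P0.
  exact: natr_neq0.
rewrite map_inj_uniq ?iota_uniq // => i j /fmorph_inj /(natr_inj hk).
by case.
Qed.

(** The torus points over k are Zariski dense.  The coordinates are released from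
    k to K one at a time, the first [j] being already arbitrary: each step is the
    one-variable case. *)
Lemma mpoly_vanish_dense m (G : {mpoly K[m]}) :
    (forall c : 'I_m -> k, (forall l, c l != 0) -> G.@[fun l => io (c l)] = 0) ->
  forall v : 'I_m -> K, G.@[v] = 0.
Proof.
move=> G0.
suff H j : (j <= m)%N -> forall v : 'I_m -> K,
    (forall l : 'I_m, (j <= l)%N -> exists2 c, c != 0 & v l = io c) -> G.@[v] = 0.
  by move=> v; apply: (H m) => // l; rewrite leqNgt ltn_ord.
elim: j => [|j IH] lt_jm v hv.
  have /fin_all_exists2 [c nzc Ec] : forall l, exists2 c, c != 0 & v l = io c.
    by move=> l; apply: hv.
  by rewrite -(G0 c nzc); apply: meval_eq.
pose jj := Ordinal lt_jm.
pose P := mmap (@polyC K) (fun l => if l == jj then 'X else (v l)%:P) G.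
have EP t : P.[t] = G.@[fun l => if l == jj then t else v l].
  rewrite -horner_evalE; apply: rmorph_mmap => [c|l].
    by rewrite /= /horner_eval hornerC.
  by rewrite /=; case: eqP => _; rewrite /horner_eval ?hornerX ?hornerC.
have -> : G.@[v] = P.[v jj].
  by rewrite EP; apply: meval_eq => l; case: eqP => [->|].
suff -> : P = 0 by rewrite horner0.
apply: poly_vanish_dense => c nzc; rewrite EP; apply: IH; first exact: ltnW.
move=> l le_jl; case: eqP => [_|/eqP ne_l]; first by exists c.
by apply: hv; rewrite ltn_neqAle le_jl andbT eq_sym; apply: ne_l.
Qed.

Lemma mpoly_proportional_dense m (f : K) (G H : {mpoly K[m]}) :
    (forall c : 'I_m -> k, (forall l, c l != 0) ->
       G.@[fun l => io (c l)] = f * H.@[fun l => io (c l)]) ->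
  forall v : 'I_m -> K, G.@[v] = f * H.@[v].
Proof.
move=> GH v; apply/eqP; rewrite -subr_eq0 -[f](mevalC v) -mevalM -mevalB; apply/eqP.
apply: mpoly_vanish_dense => c nzc.
by rewrite mevalB mevalM mevalC GH // subrr.
Qed.

End Density.

Record is_subfield (F : fieldType) (L : F -> Prop) : Prop := IsSubfield {
  subfield0 : L 0;
  subfield1 : L 1;
  subfieldN : forall x, L x -> L (- x);
  subfieldD : forall x y, L x -> L y -> L (x + y);
  subfieldM : forall x y, L x -> L y -> L (x * y);
  subfieldV : forall x, L x -> L x^-1
}.

Section Newton.
Variable K : fieldType.

Definition root_poly (s : seq K) : {poly K} := \prod_(d <- s) ('X - d%:P).
Definition psum (s : seq K) (j : nat) : K := \sum_(d <- s) d ^+ j.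

Lemma size_root_poly s : size (root_poly s) = (size s).+1.
Proof. exact: size_prod_XsubC. Qed.

Lemma root_poly_coef_size s : (root_poly s)`_(size s) = 1.
Proof.
by have /monicP := monic_prod_XsubC s xpredT id; rewrite lead_coefE size_root_poly.
Qed.

(** Synthetic division: the coefficients of P = (X - d) Q determine those of Q by
    a telescoping sum, which is finite because Q has size at most N. *)
Lemma coef_XsubC_telescope (Q : {poly K}) (d : K) i N : (size Q <= N)%N ->
  \sum_(i <= j < N) (('X - d%:P) * Q)`_j.+1 * d ^+ (j.+1 - i) = d * Q`_i.
Proof.
move=> leQN; have [le_iN|lt_Ni] := leqP i N; last first.
  rewrite big_geq 1?ltnW // nth_default ?mulr0 //.
  by rewrite (leq_trans leQN) // ltnW.
rewrite (eq_big_nat _ _ (F2 := fun j => - (d ^+ (j.+1 - i).+1 * Q`_j.+1)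
    - - (d ^+ (j - i).+1 * Q`_j))).
  rewrite telescope_sumr // nth_default // mulr0 oppr0 sub0r opprK subnn.
  by rewrite expr1.
move=> j /andP [le_ij _]; rewrite mulrBl coefB coefXM coefCM /=.
rewrite subSn // !exprS; ring.
Qed.

Lemma deriv_root_poly s :
  (root_poly s)^`() = \sum_(d <- s) root_poly s %/ ('X - d%:P).
Proof.
elim: s => [|x s IH]; first by rewrite /root_poly !big_nil derivC.
rewrite /root_poly !big_cons -/(root_poly s) derivM derivXsubC mul1r.
rewrite mulKp ?polyXsubC_eq0 // IH mulr_sumr; congr (_ + _).
apply: eq_big_seq => d s_d; rewrite divp_mulA // dvdp_XsubCl.
by rewrite root_prod_XsubC.
Qed.

(** Compare coefficients in X P' = sum_d X P / (X - d), where
    X P / (X - d) = P + d P / (X - d). *)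
Lemma newton_identity (s : seq K) i :
  (size s)%:R * (root_poly s)`_i + \sum_(i <= j < size s)
     (root_poly s)`_j.+1 * psum s (j.+1 - i) = i%:R * (root_poly s)`_i.
Proof.
pose Q d := root_poly s %/ ('X - d%:P).
have QE d : d \in s -> root_poly s = ('X - d%:P) * Q d.
  by move=> s_d; rewrite mulrC divpK // dvdp_XsubCl root_prod_XsubC.
have sQ d : d \in s -> (size (Q d) <= size s)%N.
  by move=> s_d; rewrite size_divp ?polyXsubC_eq0 // size_root_poly size_XsubC subn1.
have -> : i%:R * (root_poly s)`_i = ('X * (root_poly s)^`())`_i.
  by rewrite coefXM coef_deriv; case: i => [|i] /=; rewrite ?mul0r // mulr_natl.
rewrite deriv_root_poly mulr_sumr coef_sum.
under [in RHS]eq_big_seq => d s_d.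
  have -> : 'X * Q d = root_poly s + d%:P * Q d.
    by rewrite {1}(QE d s_d) mulrBl subrK.
  rewrite coefD coefCM -(coef_XsubC_telescope d i (sQ d s_d)) -(QE d s_d).
over.
rewrite big_split /= big_const_seq iter_addr_0 count_predT; congr (_ + _).
  by rewrite mulr_natl.
rewrite exchange_big /=; apply: eq_bigr => j _.
by rewrite /psum mulr_sumr.
Qed.

(** Newton's identities solved for the coefficients, from the leading one
    downwards.  The power sums of exponent 0 do not occur, so that zero elements
    may be deleted from [s] without leaving [L]. *)
Lemma root_poly_coef_psum (L : K -> Prop) (s : seq K) :
    is_subfield L -> [pchar K] =i pred0 -> (forall j, L (psum s j.+1)) ->
  forall i, L (root_poly s)`_i.
Proof.
move=> hL hK Lp i; have [L0 L1 LN LD LM LV] := hL.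
have Lnat j : L j%:R by elim: j => [|j IH]; rewrite ?mulrS; auto.
have [lt_si|le_is] := ltnP (size s) i.
  by rewrite nth_default ?size_root_poly.
have [l] := ubnP (size s - i); elim: l => // l IH in i le_is *.
rewrite ltnS; case: ltngtP le_is => // [lt_is _|-> _ _]; last first.
  by rewrite root_poly_coef_size.
move=> le_l; have := newton_identity s i.
set S := bigop _ _ _ => E.
have LS : L S.
  rewrite /S big_seq; apply: big_ind => // j; rewrite mem_index_iota => /andP [le_ij lt_js].
  by rewrite subSn //; apply: LM => //; apply: IH => //; lia.
have [e Ee] : exists e, (size s - i = e.+1)%N by exists (size s - i).-1; lia.
have ne : e.+1%:R != 0 :> K by apply: natr_neq0.
suff -> : (root_poly s)`_i = - e.+1%:R^-1 * S.
  by apply: LM => //; apply/LN/LV/Lnat.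
apply: (mulfI ne); rewrite mulrA mulrN divff // mulN1r -Ee natrB 1?ltnW //.
by rewrite mulrBl; apply/eqP; rewrite -subr_eq0 opprK addrAC E subrr.
Qed.

(** If all power sums of positive exponent vanish, then Newton's identity for the
    constant coefficient makes the product of the elements vanish. *)
Lemma psum_neq0 (s : seq K) : [pchar K] =i pred0 ->
  s != [::] -> 0 \notin s -> exists j, psum s j.+1 != 0.
Proof.
move=> hK ne_s s0.
have [/existsP [j hj]|] := boolP [exists j : 'I_(size s), psum s j.+1 != 0].
  by exists j.
rewrite negb_exists => /forallP h0; case/negP: s0.
have := newton_identity s 0; rewrite mul0r big_nat big1 ?addr0 => [/eqP|j /andP [_ lt_j]].
  rewrite mulf_eq0 (negPf (natr_neq0 _ _)) ?lt0n ?size_eq0 //=.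
  by rewrite -horner_coef0 -/(root _ _) root_prod_XsubC.
by have /negPn/eqP := h0 (Ordinal lt_j); rewrite subn0 /= => ->; rewrite mulr0.
Qed.

End Newton.

(** * The function E_m and the observables at a point *)

Section PowerSums.
Variables (L : fieldType) (m n : nat).
Implicit Types (V : 'M[L]_(m, n)) (r : 'I_m -> int).

Definition monom V r j : L := \prod_(l < m) V l j ^ r l.
Definition powsum V r : L := \sum_(j < n) monom V r j.
Definition observable_at V r : L := \sum_(i < n) \sum_(j < n) monom V r i / monom V r j.
Definition Efun_at V : L :=
  \sum_(j < n) \sum_(js : {ffun 'I_m -> 'I_n})
    ((\prod_(l < m) V l (js l)) / (\prod_(l < m) V l j)
     + (\prod_(l < m) V l j) / (\prod_(l < m) V l (js l))).

Lemma observable_at_powsum V r :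
  observable_at V r = powsum V r * \sum_(j < n) (monom V r j)^-1.
Proof.
by rewrite /observable_at /powsum mulr_suml; apply: eq_bigr => i _; rewrite mulr_sumr.
Qed.

Lemma Efun_at_powsum V :
  Efun_at V = (\prod_(l < m) \sum_(j < n) V l j) * (\sum_(j < n) (\prod_(l < m) V l j)^-1)
    + (\prod_(l < m) \sum_(j < n) (V l j)^-1) * (\sum_(j < n) \prod_(l < m) V l j).
Proof.
rewrite !bigA_distr_bigA /= !mulr_sumr -big_split /=; apply: eq_bigr => j _.
rewrite !mulr_suml -big_split /=; apply: eq_bigr => js _.
by rewrite prodfV; congr (_ + _); rewrite mulrC.
Qed.

Lemma Efun_at_scale V (c : 'I_m -> L) : (forall l, c l != 0) ->
  Efun_at (\matrix_(l, j) (c l * V l j)) = Efun_at V.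
Proof.
move=> nzc; rewrite !Efun_at_powsum.
have C0 : \prod_(l < m) c l != 0 by apply/prodf_neq0.
have E1 : \prod_(l < m) \sum_(j < n) (\matrix_(l, j) (c l * V l j)) l j =
    (\prod_(l < m) c l) * \prod_(l < m) \sum_(j < n) V l j.
  rewrite -big_split /=; apply: eq_bigr => l _; rewrite mulr_sumr.
  by apply: eq_bigr => j _; rewrite mxE.
have E2 : \prod_(l < m) \sum_(j < n) ((\matrix_(l, j) (c l * V l j)) l j)^-1 =
    (\prod_(l < m) c l)^-1 * \prod_(l < m) \sum_(j < n) (V l j)^-1.
  rewrite -prodfV -big_split /=; apply: eq_bigr => l _; rewrite mulr_sumr.
  by apply: eq_bigr => j _; rewrite mxE invfM.
have E3 j : \prod_(l < m) (\matrix_(l, j) (c l * V l j)) l j =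
    (\prod_(l < m) c l) * \prod_(l < m) V l j.
  by rewrite -big_split /=; apply: eq_bigr => l _; rewrite mxE.
have E4 : \sum_(j < n) (\prod_(l < m) (\matrix_(l, j) (c l * V l j)) l j)^-1 =
    (\prod_(l < m) c l)^-1 * \sum_(j < n) (\prod_(l < m) V l j)^-1.
  by rewrite mulr_sumr; apply: eq_bigr => j _; rewrite E3 invfM.
have E5 : \sum_(j < n) \prod_(l < m) (\matrix_(l, j) (c l * V l j)) l j =
    (\prod_(l < m) c l) * \sum_(j < n) \prod_(l < m) V l j.
  by rewrite mulr_sumr; apply: eq_bigr => j _; rewrite E3.
by rewrite E1 E2 E4 E5; field.
Qed.

Lemma Efun_at_inv V : Efun_at (\matrix_(l, j) (V l j)^-1) = Efun_at V.
Proof.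
rewrite !Efun_at_powsum addrC; congr (_ + _); congr (_ * _).
- by apply: eq_bigr => l _; apply: eq_bigr => j _; rewrite mxE invrK.
- by apply: eq_bigr => j _; rewrite -prodfV; apply: eq_bigr => l _; rewrite mxE.
- by apply: eq_bigr => l _; apply: eq_bigr => j _; rewrite mxE.
apply: eq_bigr => j _; rewrite -prodfV; apply: eq_bigr => l _.
by rewrite mxE invrK.
Qed.

Lemma Efun_at_perm V (s : {perm 'I_n}) : Efun_at (\matrix_(l, j) V l (s j)) = Efun_at V.
Proof.
have R (F : 'I_n -> L) : \sum_(j < n) F (s j) = \sum_(j < n) F j.
  by rewrite [RHS](reindex_inj (@perm_inj _ s)).
rewrite !Efun_at_powsum; congr (_ * _ + _ * _).
- by apply: eq_bigr => l _; rewrite -[RHS]R; apply: eq_bigr => j _; rewrite mxE.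
- rewrite -[RHS]R; apply: eq_bigr => j _; congr (_^-1).
  by apply: eq_bigr => l _; rewrite mxE.
- by apply: eq_bigr => l _; rewrite -[RHS]R; apply: eq_bigr => j _; rewrite mxE.
rewrite -[RHS]R; apply: eq_bigr => j _.
by apply: eq_bigr => l _; rewrite mxE.
Qed.

End PowerSums.

(** * Specialization of rational functions *)

Lemma frac_cross_mul (R : idomainType) (a b c d : R) : b != 0 -> d != 0 ->
  tofrac a / tofrac b = tofrac c / tofrac d :> {fraction R} -> a * d = c * b.
Proof.
move=> nb nd /eqP; rewrite eqr_div ?tofrac_eq0 // -!tofracM tofrac_eq.
by move/eqP.
Qed.

Lemma frac_add (R : idomainType) (a b c d : R) : b != 0 -> d != 0 ->
  tofrac a / tofrac b + tofrac c / tofrac d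
    = tofrac (a * d + c * b) / tofrac (b * d) :> {fraction R}.
Proof. by move=> nb nd; rewrite addf_div ?tofrac_eq0 // tofracD !tofracM. Qed.

Lemma frac_mul (R : idomainType) (a b c d : R) :
  (tofrac a / tofrac b) * (tofrac c / tofrac d)
    = tofrac (a * c) / tofrac (b * d) :> {fraction R}.
Proof. by rewrite mulf_div !tofracM. Qed.

Section Specialization.
Variables (k L : fieldType) (m n : nat) (io : {rmorphism k -> L}).
Local Notation K := (ratfun k m n).
Implicit Types (V : 'M[L]_(m, n)) (p : {mpoly k[m * n]}) (f g : K).

Definition evalp V p : L := mmap io (mxvec V ord0) p.
HB.instance Definition _ V := GRing.RMorphism.copy (evalp V) (mmap io (mxvec V ord0)).

Lemma evalpC V c : evalp V c%:MP = io c.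
Proof. by rewrite /evalp mmapC. Qed.

Lemma evalpX V l j : evalp V 'X_(mxvec_index l j) = V l j.
Proof. by rewrite /evalp mmapX mmap1U mxvecE. Qed.

(** Evaluation of a rational function at a point, as a partial function: it is
    defined when some representing fraction has a denominator that does not vanish
    at [V].  The point may have coordinates in a field [L] that contains no copy
    of k(x_ij), or in k(x_ij) itself, where it is a substitution. *)
Definition specializes V f (y : L) : Prop :=
  exists a b, [/\ evalp V b != 0, f = tofrac a / tofrac b & y = evalp V a / evalp V b].

Lemma evalp_neq0 V b : evalp V b != 0 -> b != 0.
Proof. by apply: contra_neq => ->; rewrite rmorph0. Qed.

Lemma specializes_fun V f y z : specializes V f y -> specializes V f z -> y = z.
Proof.
move=> [a [b [nb -> ->]]] [c [d [nd E ->]]].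
have /(congr1 (evalp V)) := frac_cross_mul (evalp_neq0 nb) (evalp_neq0 nd) E.
by rewrite !(rmorphM (evalp V)) => E'; apply/eqP; rewrite eqr_div // E'.
Qed.

Lemma specializes_tofrac V p : specializes V (tofrac p) (evalp V p).
Proof. by exists p, 1; rewrite !rmorph1 !divr1 oner_neq0. Qed.

Lemma specializes_const V c : specializes V (ratC m n c) (io c).
Proof. by rewrite -(evalpC V); apply: specializes_tofrac. Qed.

Lemma specializes_xvar V l j : specializes V (xvar k l j) (V l j).
Proof. by rewrite -(evalpX V); apply: specializes_tofrac. Qed.

Lemma specializes0 V : specializes V 0 0.
Proof. by have := specializes_tofrac V 0; rewrite !rmorph0. Qed.

Lemma specializes1 V : specializes V 1 1.
Proof. by have := specializes_tofrac V 1; rewrite !rmorph1. Qed.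

Lemma specializesD V f g y z :
  specializes V f y -> specializes V g z -> specializes V (f + g) (y + z).
Proof.
move=> [a [b [nb -> ->]]] [c [d [nd -> ->]]]; exists (a * d + c * b), (b * d).
rewrite (frac_add _ _ (evalp_neq0 nb) (evalp_neq0 nd)) addf_div //.
by rewrite (rmorphD (evalp V)) !(rmorphM (evalp V)) mulf_neq0.
Qed.

Lemma specializesM V f g y z :
  specializes V f y -> specializes V g z -> specializes V (f * g) (y * z).
Proof.
move=> [a [b [nb -> ->]]] [c [d [nd -> ->]]]; exists (a * c), (b * d).
by rewrite frac_mul !(rmorphM (evalp V)) mulf_neq0 // mulf_div.
Qed.

Lemma specializesV V f y : y != 0 -> specializes V f y -> specializes V f^-1 y^-1.
Proof.
move=> nz [a [b [nb -> Ey]]]; exists b, a; rewrite Ey !invf_div; split=> //.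
by apply: contraNneq nz; rewrite Ey => ->; rewrite mul0r.
Qed.

Lemma specializes_sum V I (r : seq I) (F : I -> K) (y : I -> L) :
  (forall i, specializes V (F i) (y i)) ->
  specializes V (\sum_(i <- r) F i) (\sum_(i <- r) y i).
Proof.
move=> H; apply: (big_rec2 (specializes V)) => [|i u v _]; first exact: specializes0.
exact: specializesD.
Qed.

Lemma specializes_prod V I (r : seq I) (F : I -> K) (y : I -> L) :
  (forall i, specializes V (F i) (y i)) ->
  specializes V (\prod_(i <- r) F i) (\prod_(i <- r) y i).
Proof.
move=> H; apply: (big_rec2 (specializes V)) => [|i u v _]; first exact: specializes1.
exact: specializesM.
Qed.

Lemma specializesX V f y e : specializes V f y -> specializes V (f ^+ e) (y ^+ e).
Proof.
move=> H; elim: e => [|e IH]; first exact: specializes1.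
by rewrite !exprS; apply: specializesM.
Qed.

Lemma specializesXz V f y (e : int) : y != 0 ->
  specializes V f y -> specializes V (f ^ e) (y ^ e).
Proof.
move=> nz H; case: e => e; first exact: specializesX.
by rewrite !NegzE -!exprz_inv; apply: specializesX; apply: specializesV.
Qed.

Lemma specializes_polyval V N (q : 'I_N -> K) (y : 'I_N -> L) (P : {mpoly k[N]}) :
  (forall t, specializes V (q t) (y t)) -> specializes V (polyval q P) (mmap io y P).
Proof.
move=> H; apply: specializes_sum => u; apply: specializesM.
  exact: specializes_const.
by apply: specializes_prod => t; apply: specializesX.
Qed.

Section NonzeroPoint.
Variable V : 'M[L]_(m, n).
Hypothesis nzV : forall l j, V l j != 0.

Lemma specializes_observable r : specializes V (observable k n r) (observable_at V r).
Proof.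
have M j : specializes V (\prod_(l < m) xvar k l j ^ r l) (monom V r j).
  by apply: specializes_prod => l; apply: specializesXz => //; apply: specializes_xvar.
apply: specializes_sum => i; apply: specializes_sum => j; apply: specializesM => //.
apply: specializesV => //; apply/prodf_neq0 => l _; exact: expfz_neq0.
Qed.

Lemma specializes_Efun : specializes V (Efun k m n) (Efun_at V).
Proof.
apply: specializes_sum => j; apply: specializes_sum => js.
have M (t : 'I_m -> 'I_n) : specializes V (\prod_(l < m) xvar k l (t l)) (\prod_(l < m) V l (t l)).
  by apply: specializes_prod => l; apply: specializes_xvar.
have nzM (t : 'I_m -> 'I_n) : \prod_(l < m) V l (t l) != 0 by apply/prodf_neq0 => l _.
apply: specializesD; apply: specializesM.
- exact: M.
- by apply: specializesV; [apply: (nzM (fun=> j)) | apply: (M (fun=> j))].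
- exact: (M (fun=> j)).
by apply: specializesV.
Qed.

End NonzeroPoint.

(** The values of polynomials in the observables at a point are the same
    polynomials in the values of the observables. *)
Lemma polynomial_no_separation V V' :
    (forall l j, V l j != 0) -> (forall l j, V' l j != 0) ->
    (forall r, observable_at V r = observable_at V' r) ->
  polynomial_in_observables (Efun k m n) -> Efun_at V = Efun_at V'.
Proof.
move=> nzV nzV' eq_obs [N [r [P EP]]].
have H (W : 'M[L]_(m, n)) : (forall l j, W l j != 0) ->
    Efun_at W = mmap io (fun t => observable_at W (r t)) P.
  move=> nzW; apply: specializes_fun (specializes_Efun nzW) _; rewrite EP.
  by apply: specializes_polyval => t; apply: specializes_observable.
rewrite (H V nzV) (H V' nzV') /mmap; apply: eq_bigr => u _; congr (_ * _).
by apply: mmap1_eq => t; apply: eq_obs.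
Qed.

End Specialization.

(** * Laurent sums over all maps between pairs, and the field of the observables *)

Section Quotients.
Variables (F : fieldType) (S : F -> Prop).

Definition quotient_of f := exists a b, [/\ S a, S b, b != 0 & f = a / b].

Lemma quotient_subfield : S 1 -> S (-1) ->
    (forall x y, S x -> S y -> S (x + y)) -> (forall x y, S x -> S y -> S (x * y)) ->
  is_subfield quotient_of.
Proof.
move=> S1 SN1 SD SM; have Sq x : S x -> quotient_of x.
  by move=> Sx; exists x, 1; rewrite oner_neq0 divr1.
have S0 : S 0 by rewrite -(subrr 1); apply: SD.
split; [exact: Sq | exact: Sq | | | |].
- move=> _ [a [b [Sa Sb nb ->]]]; exists (-1 * a), b.
  by rewrite mulN1r mulNr; split=> //; rewrite -mulN1r; apply: SM.
- move=> _ _ [a [b [Sa Sb nb ->]]] [c [d [Sc Sd nd ->]]].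
  by exists (a * d + c * b), (b * d); rewrite mulf_neq0 // addf_div //; split; auto.
- move=> _ _ [a [b [Sa Sb nb ->]]] [c [d [Sc Sd nd ->]]].
  by exists (a * c), (b * d); rewrite mulf_neq0 // mulf_div; split; auto.
move=> _ [a [b [Sa Sb nb ->]]]; have [->|na] := eqVneq a 0.
  by rewrite mul0r invr0; apply: Sq.
by exists b, a; rewrite invf_div.
Qed.

End Quotients.

Section LaurentSums.
Variables (F : fieldType) (L : F -> Prop).
Hypotheses (subL : is_subfield L) (hF : [pchar F] =i pred0).
Variables (A P : finType) (m : nat) (v : 'I_m -> A -> F).
Hypothesis nzv : forall l a, v l a != 0.
Hypothesis L_powsum : forall r : 'I_m -> int, L (\sum_a \prod_(l < m) v l a ^ r l).

Let L_0 := subfield0 subL.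
Let L_1 := subfield1 subL.
Let L_N := subfieldN subL.
Let L_D := subfieldD subL.
Let L_M := subfieldM subL.
Let L_V := subfieldV subL.

Local Notation T := {ffun P -> A}.

(** A general monomial in the points v_(tau a), a in [P]: the factor with
    exponents [r a] comes from the point chosen by [tau] at [a]. *)
Definition choice_monomial (r : P -> 'I_m -> int) (tau : T) : F :=
  \prod_(a : P) \prod_(l < m) v l (tau a) ^ r a l.

(** Laurent polynomials over [L] in the points v_(tau a), regarded as functions
    of [tau] only. *)
Inductive laurent : (T -> F) -> Prop :=
| LaurentMonomial c r h :
    L c -> (forall tau, h tau = c * choice_monomial r tau) -> laurent h
| LaurentD h1 h2 h :
    laurent h1 -> laurent h2 -> (forall tau, h tau = h1 tau + h2 tau) -> laurent h.

(** The points v_(tau a) are chosen independently for different [a], so the sum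
    of a monomial over all [tau] is a product of power sums. *)
Lemma laurent_total_sum h : laurent h -> L (\sum_(tau : T) h tau).
Proof.
elim=> [c r {}h Lc Eh|h1 h2 {}h _ IH1 _ IH2 Eh].
  under eq_bigr do rewrite Eh; rewrite -mulr_sumr; apply: L_M => //.
  rewrite -(bigA_distr_bigA (fun a b => \prod_(l < m) v l b ^ r a l)) /=.
  exact: (big_ind L).
by under eq_bigr do rewrite Eh; rewrite big_split; apply: L_D.
Qed.

Lemma laurent_ext h h' : laurent h -> h =1 h' -> laurent h'.
Proof.
case=> [c r {}h Rc Eh|h1 h2 {}h L1 L2 Eh] eqh.
  by apply: (LaurentMonomial (r := r) Rc) => tau; rewrite -eqh.
by apply: (LaurentD L1 L2) => tau; rewrite -eqh.
Qed.

Lemma choice_monomialM r s tau : choice_monomial r tau * choice_monomial s tau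
  = choice_monomial (fun a l => r a l + s a l) tau.
Proof.
rewrite /choice_monomial -big_split; apply: eq_bigr => a _ /=.
rewrite -big_split; apply: eq_bigr => l _ /=.
by rewrite expfzDr ?nzv.
Qed.

Lemma laurentM h1 h2 h :
  laurent h1 -> laurent h2 -> (forall tau, h tau = h1 tau * h2 tau) -> laurent h.
Proof.
move=> L1; elim: L1 h2 h => [c r {}h1 Rc E1|a b {}h1 _ IHa _ IHb E1] h2 h L2.
  elim: L2 h => [d s {}h2 Rd E2|a b {}h2 _ IHa _ IHb E2] h Eh.
    apply: (LaurentMonomial (L_M Rc Rd)) => tau.
    by rewrite Eh E1 E2 mulrACA choice_monomialM.
  have La := IHa _ (fun=> erefl); have Lb := IHb _ (fun=> erefl).
  by apply: (LaurentD La Lb) => tau; rewrite Eh E2 mulrDr.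
move=> Eh; have La := IHa _ _ L2 (fun=> erefl); have Lb := IHb _ _ L2 (fun=> erefl).
by apply: (LaurentD La Lb) => tau; rewrite Eh E1 mulrDl.
Qed.

Lemma laurent_const c : L c -> laurent (fun=> c).
Proof.
move=> Rc; apply: (LaurentMonomial (r := fun _ _ => 0) Rc) => tau.
by rewrite /choice_monomial big1 ?mulr1 // => a _; rewrite big1 // => l _; rewrite expr0z.
Qed.

Lemma laurent_ratio l a : laurent (fun tau => v l (tau a)).
Proof.
apply: (LaurentMonomial (r := fun b l' => ((b == a) && (l' == l))%:R) L_1) => tau.
rewrite mul1r /choice_monomial (bigD1 a) //= (bigD1 l) //= !eqxx big1 => [|l' nl].
  rewrite mulr1 big1 ?mulr1 ?expr1z // => b nb.
  by rewrite big1 // => l' _; rewrite (negPf nb) expr0z.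
by rewrite (negPf nl) andbF expr0z.
Qed.

Lemma laurentN h : laurent h -> laurent (fun tau => - h tau).
Proof.
move=> Lh; apply: (laurentM (laurent_const (L_N L_1)) Lh) => tau.
by rewrite mulN1r.
Qed.

Lemma laurent_sum I (r : seq I) (h : I -> T -> F) :
  (forall i, laurent (h i)) -> laurent (fun tau => \sum_(i <- r) h i tau).
Proof.
move=> Lh; elim: r => [|i r IH].
  by apply: (laurent_ext (laurent_const L_0)) => tau; rewrite big_nil.
by apply: (LaurentD (Lh i) IH) => tau; rewrite big_cons.
Qed.

Lemma laurent_prod I (r : seq I) (Q : pred I) (h : I -> T -> F) :
  (forall i, laurent (h i)) -> laurent (fun tau => \prod_(i <- r | Q i) h i tau).
Proof.
move=> Lh; elim: r => [|i r IH].
  by apply: (laurent_ext (laurent_const L_1)) => tau; rewrite big_nil.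
case Qi: (Q i).
  by apply: (laurentM (Lh i) IH) => tau; rewrite big_cons Qi.
by apply: (laurent_ext IH) => tau; rewrite big_cons Qi.
Qed.

Lemma laurentX h e : laurent h -> laurent (fun tau => h tau ^+ e).
Proof.
move=> Lh; elim: e => [|e IH]; first exact: (laurent_const L_1).
by apply: (laurentM Lh IH) => tau; rewrite exprS.
Qed.

Lemma laurent_mmap (R : nzRingType) (io : {rmorphism R -> F}) N
    (y : 'I_N -> T -> F) (p : {mpoly R[N]}) :
    (forall c, L (io c)) -> (forall t, laurent (y t)) ->
  laurent (fun tau => mmap io (fun t => y t tau) p).
Proof.
move=> Lio Ly; apply: laurent_sum => u; apply: laurentM (fun=> erefl).
  exact: laurent_const.
by apply: laurent_prod => t; apply: laurentX.
Qed.

(** If S is the polynomial with simple factors at all nonzero values of [h], then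
    S(h) / S(0) is the indicator function; the power sums of these values are the
    total sums of the powers of [h], so S has coefficients in [L]. *)
Lemma laurent_zero_indicator h : laurent h -> laurent (fun tau => (h tau == 0)%:R).
Proof.
move=> Lh; pose s := [seq h tau | tau <- enum T & h tau != 0].
have Ls i : L (root_poly s)`_i.
  apply: root_poly_coef_psum => // j.
  have := laurent_total_sum (laurentX j.+1 Lh).
  rewrite /psum big_map big_filter big_enum_cond /=; congr L.
  rewrite [RHS]big_mkcond /=; apply: eq_bigr => tau _.
  by case: eqP => [->|]; rewrite ?expr0n.
have nz0 : (root_poly s).[0] != 0.
  rewrite -/(root _ _) root_prod_XsubC; apply/mapP => -[tau].
  by rewrite mem_filter => /andP [/negPf nz _] /eqP; rewrite eq_sym nz.
have L01 : laurent (fun tau => (root_poly s).[0]^-1 * (root_poly s).[h tau]).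
  apply: laurentM (fun=> erefl).
    by apply: laurent_const; apply: L_V; rewrite horner_coef0.
  pose G (i : 'I_(size (root_poly s))) (tau : T) := (root_poly s)`_i * h tau ^+ i.
  apply: (laurent_ext (h := fun tau => \sum_i G i tau)) => [|tau].
    apply: laurent_sum => i; apply: laurentM (fun=> erefl).
      exact: laurent_const.
    exact: laurentX.
  by rewrite horner_coef.
apply: (laurent_ext L01) => tau; have [->|nz] := eqVneq; first by rewrite mulVf.
rewrite (_ : _.[h tau] = 0) ?mulr0 //; apply/rootP.
by rewrite root_prod_XsubC map_f // mem_filter nz mem_enum.
Qed.

Section ZeroLocus.
Variables (I : finType) (R : I -> T -> F).
Hypothesis laurentR : forall i, laurent (R i).
Local Notation zero_locus := (fun tau => [forall i, R i tau == 0]).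

Lemma zero_locus_sum h : laurent h -> L (\sum_(tau : T | zero_locus tau) h tau).
Proof.
move=> Lh; have LD : laurent (fun tau => \prod_i (R i tau == 0)%:R).
  by apply: laurent_prod => i; apply: laurent_zero_indicator.
have := laurent_total_sum (laurentM LD Lh (fun=> erefl)).
rewrite [in X in _ -> X]big_mkcond; congr L; apply: eq_bigr => tau _.
case: ifP => [/forallP H|/negbT]; first by rewrite big1 ?mul1r // => i _; rewrite H.
by rewrite negb_forall => /existsP [i /negPf ne]; rewrite (bigD1 i) //= ne !mul0r.
Qed.

(** The relation a = f b at all zeros of the [R i] gives f as a quotient of the
    sums of a b^j and b^(j+1) over these zeros, for any [j] for which the latter
    does not vanish. *)
Lemma zero_locus_ratio (f : F) (a b : T -> F) (tau0 : T) :
    laurent a -> laurent b -> (forall tau, zero_locus tau -> a tau = f * b tau) ->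
  zero_locus tau0 -> b tau0 != 0 -> L f.
Proof.
move=> La Lb ab zero0 nzb0.
pose s := [seq b tau | tau <- enum T & zero_locus tau && (b tau != 0)].
have [||j nzj] := psum_neq0 (s := s) hF.
- suff : b tau0 \in s by apply: contraTneq => ->.
  by apply: map_f; rewrite mem_filter zero0 nzb0 mem_enum.
- by apply/mapP => -[tau]; rewrite mem_filter => /andP [/andP [_ /eqP nz] _] /esym.
have Ej : psum s j.+1 = \sum_(tau | zero_locus tau) b tau ^+ j.+1.
  rewrite /psum big_map big_filter big_enum_cond /= big_mkcondr /=.
  by apply: eq_bigr => tau _; case: eqP => [->|]; rewrite ?expr0n.
have -> : f = (\sum_(tau | zero_locus tau) a tau * b tau ^+ j)
            * (\sum_(tau | zero_locus tau) b tau ^+ j.+1)^-1.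
  rewrite -Ej; apply: (mulIf nzj); rewrite mulfVK // Ej mulr_sumr.
  by apply: eq_bigr => tau z; rewrite ab // exprS mulrA.
apply: L_M; last apply: L_V; apply: zero_locus_sum; last exact: laurentX.
by apply: (laurentM La (laurentX j Lb)) => tau.
Qed.

End ZeroLocus.
End LaurentSums.

Section ObservableField.
Variables (k : fieldType) (m n : nat).
Local Notation K := (ratfun k m n).
Local Notation PO := (@polynomial_in_observables k m n).
Local Notation RO := (@rational_in_observables k m n).
Implicit Types (f g : K).

(** Two finite lists of exponents are concatenated. *)
Lemma polynomial_common f g : PO f -> PO g ->
  exists (N : nat) (r : 'I_N -> 'I_m -> int) (P Q : {mpoly k[N]}),
    f = polyval (fun t => observable k n (r t)) P
    /\ g = polyval (fun t => observable k n (r t)) Q.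
Proof.
move=> [N1 [r1 [P1 ->]]] [N2 [r2 [P2 ->]]].
pose r t := match split t with inl i => r1 i | inr i => r2 i end.
pose q (t : 'I_(N1 + N2)) := observable k n (r t).
have H N (s : 'I_N -> 'I_(N1 + N2)) (P : {mpoly k[N]}) :
    polyval (fun t => q (s t)) P = polyval q (mmap (@mpolyC _ k) (fun t => 'X_(s t)) P).
  symmetry; apply: rmorph_mmap => [c|t]; first by rewrite /= mmapC.
  by rewrite /= mmapX mmap1U.
exists (N1 + N2)%N, r.
exists (mmap (@mpolyC _ k) (fun t => 'X_(lshift N2 t)) P1).
exists (mmap (@mpolyC _ k) (fun t => 'X_(rshift N1 t)) P2).
rewrite -!H; split; apply: eq_bigr => u _; congr (_ * _); apply: mmap1_eq => t.
  by rewrite /q /r (unsplitK (inl _ t)).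
by rewrite /q /r (unsplitK (inr _ t)).
Qed.

Lemma polynomial_const c : PO (ratC m n c).
Proof. by exists 0%N, (fun _ _ => 0), c%:MP; rewrite /polyval mmapC. Qed.

Lemma polynomial_observable r : PO (observable k n r).
Proof. by exists 1%N, (fun=> r), 'X_ord0; rewrite /polyval mmapX mmap1U. Qed.

Lemma polynomialD f g : PO f -> PO g -> PO (f + g).
Proof.
move=> Pf Pg; have [N [r [P [Q [-> ->]]]]] := polynomial_common Pf Pg.
by exists N, r, (P + Q); rewrite /polyval rmorphD.
Qed.

Lemma polynomialM f g : PO f -> PO g -> PO (f * g).
Proof.
move=> Pf Pg; have [N [r [P [Q [-> ->]]]]] := polynomial_common Pf Pg.
by exists N, r, (P * Q); rewrite /polyval rmorphM.
Qed.

Lemma rationalP f : RO f <-> quotient_of PO f.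
Proof.
split=> [[N [r [P [Q [nzQ ->]]]]]|[a [b [Pa Pb nzb ->]]]].
  by do 2!eexists; split; [exists N, r, P | exists N, r, Q | exact: nzQ |].
have [N [r [P [Q [Ea Eb]]]]] := polynomial_common Pa Pb.
by exists N, r, P, Q; move: nzb; rewrite Ea Eb.
Qed.

Lemma rational_polynomial f : PO f -> RO f.
Proof.
move=> Pf; apply/rationalP; exists f, (ratC m n 1); split=> //.
- exact: polynomial_const.
- by rewrite rmorph1 oner_neq0.
by rewrite rmorph1 divr1.
Qed.

Lemma rational_const c : RO (ratC m n c).
Proof. exact/rational_polynomial/polynomial_const. Qed.

Lemma rational_subfield : is_subfield RO.
Proof.
have [] := @quotient_subfield K PO.
- by rewrite -(rmorph1 (@ratC k m n)); apply: polynomial_const.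
- by rewrite -(rmorphN1 (@ratC k m n)); apply: polynomial_const.
- exact: polynomialD.
- exact: polynomialM.
move=> h0 h1 hN hD hM hV; split; try by apply/rationalP.
- by move=> x /rationalP /hN /rationalP.
- by move=> x y /rationalP qx /rationalP /(hD _ _ qx) /rationalP.
- by move=> x y /rationalP qx /rationalP /(hM _ _ qx) /rationalP.
by move=> x /rationalP /hV /rationalP.
Qed.

Definition ratio_at (l : 'I_m) (a : 'I_n * 'I_n) : K := xvar k l a.1 / xvar k l a.2.

Lemma observableE r :
  observable k n r = \sum_a \prod_(l < m) ratio_at l a ^ r l.
Proof.
rewrite /observable pair_big /=; apply: eq_bigr => -[i j] _ /=.
rewrite -prodf_div; apply: eq_bigr => l _.
by rewrite /ratio_at expfzMl exprz_inv invr_expz.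
Qed.

Lemma xvar_neq0 (l : 'I_m) (j : 'I_n) : xvar k l j != 0.
Proof. by rewrite tofrac_eq0 -msupp_eq0 msuppX. Qed.

Lemma ratio_at_neq0 l a : ratio_at l a != 0.
Proof. by rewrite mulf_neq0 ?invr_neq0 ?xvar_neq0. Qed.

End ObservableField.

(** * Stars of roots of type A *)

(** The hypothesis says that e_c1 - e_c2 is the sum of the roots e_a1 - e_a2 and
    e_b1 - e_b2.  Two roots whose difference is a root share exactly one endpoint,
    with the same sign. *)
Lemma roots_share (a1 a2 b1 b2 c1 c2 : nat) :
    a1 != a2 -> b1 != b2 -> c1 != c2 ->
    (forall z, (a1 == z) + (b1 == z) + (c2 == z) = (a2 == z) + (b2 == z) + (c1 == z))%N ->
  (c1 == b1) != (c2 == b2).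
Proof.
move=> na nb nc H; have [E1|n1] := eqVneq c1 b1.
  rewrite E1 in H; apply/negP => /eqP E2.
  by have := H a1; rewrite -(eqP (esym E2)) eqxx [a2 == a1]eq_sym (negPf na); lia.
have [E|na1] := eqVneq a1 c1; last first.
  by move: (H c1); rewrite (negPf na1) ![_ == c1]eq_sym eqxx (negPf n1) (negPf nc); lia.
have := H b2; rewrite -E eqxx (negPf nb).
by case: (c2 == b2) => //; lia.
Qed.

(** The centre of the star becomes the image of [i0]. When [i0] is the only index
    there is no edge, and the identity serves. *)
Lemma star_perm n (rho : 'I_n -> 'I_n * 'I_n) (i0 : 'I_n) :
    (forall i, i != i0 -> (rho i).1 != (rho i).2) ->
    (forall i j, i != i0 -> j != i0 -> i != j -> (rho i).1 != (rho j).1) ->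
    (forall i j, i != i0 -> j != i0 -> (rho i).2 = (rho j).2) ->
  exists s : {perm 'I_n}, forall i, i != i0 -> rho i = (s i, s i0).
Proof.
move=> off ne1 eq2.
have [i1 i1n|all0] := pickP (fun i => i != i0); last first.
  by exists 1%g => i ni; have := all0 i; rewrite ni.
pose s i := if i == i0 then (rho i1).2 else (rho i).1.
have s_inj : injective s.
  move=> i j; rewrite /s; have [->|ni] := eqVneq i i0; have [->|nj] := eqVneq j i0 => //.
  - by move/eqP; rewrite eq_sym (eq2 i1 j) // (negPf (off _ nj)).
  - by move/eqP; rewrite (eq2 i1 i) // (negPf (off _ ni)).
  by move=> E; apply/eqP; apply: contraT => /(ne1 i j ni nj); rewrite E eqxx.
exists (perm s_inj) => i ni; rewrite !permE /s eqxx (negPf ni) (eq2 i1 i) //.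
by case: (rho i).
Qed.

(** Edges that pairwise share exactly one endpoint, always with the same
    orientation, form a star: three of them cannot form a triangle, because in an
    oriented triangle some two edges meet head to tail. *)
Lemma root_star n (rho : 'I_n -> 'I_n * 'I_n) (i0 : 'I_n) :
    (forall i, i != i0 -> (rho i).1 != (rho i).2) ->
    (forall i j, i != i0 -> j != i0 -> i != j ->
       ((rho i).1 == (rho j).1) != ((rho i).2 == (rho j).2)) ->
  exists s : {perm 'I_n}, (forall i, i != i0 -> rho i = (s i, s i0)) \/
    (forall i, i != i0 -> rho i = (s i0, s i)).
Proof.
move=> off share.
have [/existsP [i /existsP [j /and3P [ni nj ne2]]]|/existsPn all2] :=
  boolP [exists i, exists j, [&& i != i0, j != i0 & (rho i).2 != (rho j).2]]; last first.
  have eq2 i j : i != i0 -> j != i0 -> (rho i).2 = (rho j).2.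
    move=> ni nj; apply/eqP; have /existsPn /(_ j) := all2 i.
    by rewrite ni nj negbK.
  have [|s Es] := star_perm off _ eq2; last by exists s; left.
  move=> i j ni nj ne; have := share i j ni nj ne.
  by rewrite (eq2 i j) // eqxx eqb_id.
have ne_ij : i != j by apply: contraNneq ne2 => ->.
have eq_ij : (rho i).1 = (rho j).1.
  by apply/eqP; have := share i j ni nj ne_ij; rewrite (negPf ne2) eqbF_neg negbK.
have eq1i u : u != i0 -> (rho u).1 = (rho i).1.
  move=> nu; have [->//|ne_ui] := eqVneq u i; have [->//|ne_uj] := eqVneq u j.
  apply/eqP; apply: contraNT ne2 => ne1.
  have /eqP <- : (rho u).2 == (rho i).2.
    by have := share u i nu ni ne_ui; rewrite (negPf ne1) eq_sym eqbF_neg negbK.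
  by have := share u j nu nj ne_uj; rewrite -eq_ij (negPf ne1) eq_sym eqbF_neg negbK.
pose rho' u := ((rho u).2, (rho u).1).
have [|||s Es] := @star_perm n rho' i0.
- by move=> u nu; rewrite eq_sym; apply: off.
- move=> u v nu nv ne; have := share u v nu nv ne.
  by rewrite /= !eq1i // eqxx eq_sym eqb_id.
- by move=> u v nu nv; rewrite /= !eq1i.
exists s; right=> u nu; have := Es u nu; rewrite /rho'; case: (rho u) => a b [-> ->].
by [].
Qed.

(** * The symmetry group acting by substitution *)

Section Substitution.
Variables (k : fieldType) (m n : nat).
Local Notation K := (ratfun k m n).
Local Notation spec := (specializes (@ratC k m n)).
Local Notation ev := (evalp (@ratC k m n)).
Implicit Types (V U W : 'M[K]_(m, n)) (f : K).

Definition xmat : 'M[K]_(m, n) := \matrix_(l, j) xvar k l j.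

(** Algebraic independence of the coordinates of [V]: substitution of [V] is then
    defined on all of k(x_ij). *)
Definition alg_independent V := forall b, b != 0 -> ev V b != 0.

Lemma evalp_xmat p : ev xmat p = tofrac p.
Proof.
rewrite -[in RHS](comp_mpoly_id p) /comp_mpoly; symmetry; apply: rmorph_mmap => // t.
by case/mxvec_indexP: t => l j; rewrite mxvecE mxE tnth_mktuple.
Qed.

Lemma specializes_evalp (L : fieldType) (io : {rmorphism k -> L}) V (U W : 'M[L]_(m, n)) p :
    (forall l j, specializes io U (V l j) (W l j)) ->
  specializes io U (ev V p) (evalp io W p).
Proof.
move=> H; apply: specializes_polyval => t.
by case/mxvec_indexP: t => l j; rewrite !mxvecE.
Qed.

(** A substitution with a left inverse is injective. *)
Lemma alg_independent_inverse V U :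
  (forall l j, spec U (V l j) (xvar k l j)) -> alg_independent V.
Proof.
move=> H b nzb; apply: contraNneq nzb => Vb0.
have := @specializes_evalp K (@ratC k m n) V U xmat b.
rewrite evalp_xmat Vb0 -(tofrac_eq0 b) => E; apply/eqP.
apply: (@specializes_fun _ _ _ _ (@ratC k m n) U 0); last exact: specializes0.
by apply: E => l j; rewrite mxE.
Qed.

(** Composition of substitutions: the independence of [W] ensures that the
    denominator of [f] survives both steps. *)
Lemma specializes_comp V U W f y z : alg_independent W ->
    (forall l j, spec U (V l j) (W l j)) -> spec V f y -> spec U y z -> spec W f z.
Proof.
move=> ndW H [a [b [nb -> ->]]] Uz.
have nzWb : ev W b != 0 by apply/ndW/(evalp_neq0 nb).
exists a, b; split=> //; apply: specializes_fun Uz _; apply: specializesM.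
  exact: specializes_evalp.
by apply: specializesV => //; apply: specializes_evalp.
Qed.

Lemma frac_numden (R : idomainType) (f : {fraction R}) :
  f = tofrac \n_(repr f) / tofrac \d_(repr f).
Proof.
have nzd : \d_(repr f) != 0 by apply: denom_ratioP.
apply: (canRL (mulfK _)); first by rewrite tofrac_eq0.
rewrite -{1}[f]reprK; unlock FracField.tofrac; rewrite -[LHS]FracField.pi_mul.
apply/eqmodP; rewrite /= FracField.equivfE /FracField.mulf.
by rewrite !numden_Ratio ?mulr1 ?oner_eq0 // mulrC.
Qed.

(** For the substitutions that occur here, the chosen representative of [f] gives
    the value of [f]. *)
Lemma ratsubst_specializes V f : alg_independent V -> spec V f (ratsubst V f).
Proof.
move=> ndV; exists \n_(repr f), \d_(repr f); split => //.
  by apply: ndV; apply: denom_ratioP.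
exact: frac_numden.
Qed.

Lemma ratsubst_eq V f y : alg_independent V -> spec V f y -> ratsubst V f = y.
Proof. by move=> ndV; apply: specializes_fun; apply: ratsubst_specializes. Qed.

Definition signed_perm (e : bool) (s : {perm 'I_n}) : 'M[K]_(m, n) :=
  \matrix_(l, j) if e then (xvar k l (s j))^-1 else xvar k l (s j).

Definition scaled (c : 'I_m -> K) V : 'M[K]_(m, n) := \matrix_(l, j) (c l * V l j).

Lemma signed_perm_alg_independent e s (c : 'I_m -> k) : (forall l, c l != 0) ->
  alg_independent (scaled (fun l => ratC m n (c l)) (signed_perm e s)).
Proof.
move=> nzc.
pose C l := ratC m n (c l).
have nzC l : C l != 0 by rewrite fmorph_eq0.
(* U solves y_j = c w_(s j)^(+-1) for the points w. *)
pose U : 'M[K]_(m, n) := \matrix_(l, j)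
  if e then C l / xvar k l (s^-1 j)%g else (C l)^-1 * xvar k l (s^-1 j)%g.
apply: (@alg_independent_inverse _ U) => l j; rewrite !mxE.
have Ux : spec U (xvar k l (s j)) (U l (s j)) by apply: specializes_xvar.
have UE : U l (s j) = if e then C l / xvar k l j else (C l)^-1 * xvar k l j.
  by rewrite mxE permK.
have nzU : U l (s j) != 0.
  by rewrite UE; case: ifP => _; rewrite mulf_neq0 ?invr_neq0 ?xvar_neq0 ?nzC.
have -> : xvar k l j = C l * (if e then (U l (s j))^-1 else U l (s j)).
  rewrite UE; case: (e); last by rewrite mulrA divff ?nzC ?mul1r.
  by rewrite invfM invrK mulrA divff ?nzC ?mul1r.
apply: specializesM; first exact: specializes_const.
by case: ifP => // _; apply: specializesV.
Qed.

Lemma scaled1 V : scaled (fun=> ratC m n 1) V = V.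
Proof. by apply/matrixP => l j; rewrite mxE rmorph1 mul1r. Qed.

Section Invariance.
Variable f : K.
Hypotheses (f_w : weight0 f) (f_r : self_reciprocal f) (f_s : multisymmetric f).

(** The symmetries form a group: inversion is composed with the permutation. *)
Lemma invariant_signed_perm e s : spec (signed_perm e s) f f.
Proof.
have nd b t : alg_independent (signed_perm b t).
  by rewrite -[signed_perm b t]scaled1; apply: signed_perm_alg_independent => l; apply: oner_neq0.
have Hs : spec (signed_perm false s) f f.
  have := ratsubst_specializes f (nd false s); congr (spec _ f _).
  exact: f_s.
case: e; last exact: Hs.
apply: (specializes_comp (V := signed_perm true 1%g) (nd true s) _ _ Hs) => [l j|].
  rewrite !mxE perm1; apply: specializesV; first exact: xvar_neq0.
  by have := @specializes_xvar k K m n (@ratC k m n) (signed_perm false s) l j; rewrite mxE.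
have := ratsubst_specializes f (nd true 1%g).
have -> : signed_perm true 1 = \matrix_(l, j) (xvar k l j)^-1.
  by apply/matrixP => l j; rewrite !mxE perm1.
by rewrite f_r.
Qed.

Lemma invariant_scaled_signed_perm e s (c : 'I_m -> k) : (forall l, c l != 0) ->
  spec (scaled (fun l => ratC m n (c l)) (signed_perm e s)) f f.
Proof.
move=> nzc; have nd := signed_perm_alg_independent e s nzc.
apply: (specializes_comp (V := \matrix_(l, j) (ratC m n (c l) * xvar k l j)) nd _ _
   (invariant_signed_perm e s)) => [l j|].
  rewrite !mxE; apply: specializesM; first exact: specializes_const.
  by have := @specializes_xvar k K m n (@ratC k m n) (signed_perm e s) l j; rewrite mxE.
have nd1 : alg_independent (\matrix_(l, j) (ratC m n (c l) * xvar k l j)).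
  have := signed_perm_alg_independent false 1%g nzc; congr alg_independent.
  by apply/matrixP => l j; rewrite !mxE perm1.
by have := ratsubst_specializes f nd1; rewrite f_w.
Qed.

Hypothesis hk : [pchar k] =i pred0.

(** The factors 'X_l stand for indeterminate scaling factors of the rows. *)
Definition scaling_poly V p : {mpoly K[m]} :=
  mmap (@mpolyC m K \o @ratC k m n) (mxvec (\matrix_(l, j) ('X_l * (V l j)%:MP))  ord0) p.

Lemma scaling_polyE V p (c : 'I_m -> K) : (scaling_poly V p).@[c] = ev (scaled c V) p.
Proof.
apply: rmorph_mmap => [a|t]; first by rewrite /= mevalC.
by case/mxvec_indexP: t => l j; rewrite !mxvecE !mxE rmorphM /= mevalXU mevalC.
Qed.

(** The scaling factors are now arbitrary elements of k(x_ij), in place of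
    constants: both sides are polynomials in the factors, and constants are
    dense. *)
Lemma invariant_numden e s (c : 'I_m -> K) a b : f = tofrac a / tofrac b -> b != 0 ->
  ev (scaled c (signed_perm e s)) a = f * ev (scaled c (signed_perm e s)) b.
Proof.
move=> Ef nzb; rewrite -(scaling_polyE _ a) -(scaling_polyE _ b).
apply: (mpoly_proportional_dense (io := @ratC k m n) hk) => {}c nzc.
apply: etrans (scaling_polyE _ a _) _.
apply: etrans (congr1 ( *%R f) (esym (scaling_polyE _ b _))).
have nd := signed_perm_alg_independent e s nzc nzb.
apply: (mulIf (x := (ev (scaled (fun l => ratC m n (c l)) (signed_perm e s)) b)^-1)).
  by rewrite invr_eq0.
rewrite mulfK //; apply: specializes_fun (invariant_scaled_signed_perm e s nzc).
by exists a, b.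
Qed.

(** Moving a point by constant scalars avoids the zeros of a denominator, provided
    that some scaling over k(x_ij) does. *)
Lemma exists_scaling_neq0 V b (c : 'I_m -> K) : ev (scaled c V) b != 0 ->
  exists2 c' : 'I_m -> k, (forall l, c' l != 0) & ev (scaled (fun l => ratC m n (c' l)) V) b != 0.
Proof.
move=> nz; apply: NNPP => none; case/eqP: nz; rewrite -scaling_polyE.
apply: (mpoly_vanish_dense (io := @ratC k m n) hk) => c' nzc'; rewrite scaling_polyE.
by apply/eqP; apply: contraT => nz; case: none; exists c'.
Qed.

End Invariance.
End Substitution.

(** * Reconstruction of an invariant function from the observables *)

Section Reconstruction.
Variables (k : fieldType) (m n : nat).
Local Notation K := (ratfun k m n).
Local Notation RO := (@rational_in_observables k m n).
Local Notation ev := (evalp (@ratC k m n)).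
Local Notation pair := ('I_n * 'I_n)%type.
Local Notation T := {ffun pair -> pair}.
Variables (l0 : 'I_m) (i0 : 'I_n).
Local Notation ratio_at := (@ratio_at k m n).
Local Notation laurent := (@laurent _ RO pair pair m ratio_at).

(** The first coordinates suffice to compare exponents, because already the
    variables x_1j are algebraically independent.  Vanishing of [transport (i, j)]
    says that the roots chosen at (i, j) and (j, i0) add up to the one chosen at
    (i, i0). *)
Definition transport (ij : pair) (tau : T) : K :=
  ratio_at l0 (tau ij) * ratio_at l0 (tau (ij.2, i0)) - ratio_at l0 (tau (ij.1, i0)).

(** Vanishes when [tau] sends some pair with distinct entries to the diagonal;
    such a [tau] may satisfy all relations without coming from a symmetry. *)
Definition offdiag (tau : T) : K :=
  \prod_(ij : pair | ij.1 != ij.2) (ratio_at l0 (tau ij) - 1).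

Definition based_point (tau : T) : 'M[K]_(m, n) := \matrix_(l, i) ratio_at l (tau (i, i0)).

Lemma mxvec_index_inj (l : 'I_m) : injective (fun j : 'I_n => mxvec_index l j).
Proof. by move=> i j; move/cast_ord_inj/enum_rank_inj => []. Qed.

(** After clearing denominators this compares two monomials of degree 3, exponent
    by exponent. *)
Lemma ratio_at_mul_count a b c : ratio_at l0 a * ratio_at l0 b = ratio_at l0 c ->
  forall z : nat, ((a.1 == z :> nat) + (b.1 == z :> nat) + (c.2 == z :> nat)
    = (a.2 == z :> nat) + (b.2 == z :> nat) + (c.1 == z :> nat))%N.
Proof.
move=> E z; have [lt_zn|le_nz] := ltnP z n; last first.
  have F (i : 'I_n) : (i == z :> nat) = false.
    by apply/negbTE; apply: contraTneq (ltn_ord i) => ->; rewrite -leqNgt.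
  by rewrite !F.
have nz (j : 'I_n) := xvar_neq0 k l0 j.
have : xvar k l0 a.1 * xvar k l0 b.1 * xvar k l0 c.2
     = xvar k l0 a.2 * xvar k l0 b.2 * xvar k l0 c.1.
  move/eqP: E; rewrite /ratio_at mulf_div eqr_div ?mulf_neq0 // => /eqP ->.
  by rewrite mulrC.
rewrite /xvar -!tofracM => /eqP; rewrite tofrac_eq -!mpolyXD => /eqP.
move/(congr1 (fun p : {mpoly k[m * n]} => msupp p)); rewrite !msuppX.
move/(congr1 (head 0%MM)) => /=.
move/(congr1 (fun u : 'X_{1.. m * n} => u (mxvec_index l0 (Ordinal lt_zn)))).
by rewrite !mnmDE !mnm1E !(inj_eq (@mxvec_index_inj l0)) -!val_eqE.
Qed.

Lemma ratio_at_diag l a : a.1 = a.2 -> ratio_at l a = 1.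
Proof. by rewrite /ratio_at => ->; rewrite divff ?xvar_neq0. Qed.

Lemma ratio_at_eq1 a : (ratio_at l0 a == 1) = (a.1 == a.2).
Proof.
apply/eqP/eqP => [E|]; last exact: ratio_at_diag.
have := @ratio_at_mul_count a (i0, i0) (i0, i0).
rewrite E mul1r => /(_ erefl a.1) /=; rewrite eqxx.
by have [/val_inj ->//|_] := eqVneq (val a.2) (val a.1); lia.
Qed.

Lemma offdiag_id : offdiag (finfun id) != 0.
Proof.
by apply/prodf_neq0 => -[i j] /= ne; rewrite ffunE subr_eq0 ratio_at_eq1.
Qed.

Lemma transport_id ij : transport ij (finfun id) = 0.
Proof.
rewrite /transport !ffunE /ratio_at /= mulrA divfK ?subrr //.
exact: xvar_neq0.
Qed.

(** The roots at (i, i0), for i different from i0, pairwise differ by a root, so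
    they form a star: all of them are e_(s i) - e_(s i0), or all are the
    opposites. *)
Lemma consistent_symmetry (tau : T) :
    (forall ij, transport ij tau = 0) -> offdiag tau != 0 ->
  exists (e : bool) (s : {perm 'I_n}) (c : 'I_m -> K),
    based_point tau = scaled c (signed_perm k m e s).
Proof.
move=> tau0 /prodf_neq0 off.
pose rho i := tau (i, i0).
have cnt i j := ratio_at_mul_count (subr0_eq (tau0 (i, j))).
have offd i j : i != j -> (tau (i, j)).1 != (tau (i, j)).2.
  by move=> ne; have := off (i, j) ne; rewrite subr_eq0 ratio_at_eq1.
have diag0 : (rho i0).1 = (rho i0).2.
  have := cnt i0 i0 (rho i0).1; rewrite /= -/(rho i0) eqxx.
  by have [/val_inj ->//|_] := eqVneq (val (rho i0).2) (val (rho i0).1); lia.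
have [||s Es] := @root_star n rho i0.
- by move=> i ni; apply: offd.
- move=> i j ni nj ne; have := cnt i j; apply: roots_share; exact: offd.
case: Es => Es; [exists false, s, (fun l => (xvar k l (s i0))^-1)
                | exists true, s, (fun l => xvar k l (s i0))].
  apply/matrixP => l i; rewrite !mxE -/(rho i); have [->|ni] := eqVneq i i0.
    by rewrite ratio_at_diag // mulVf ?xvar_neq0.
  by rewrite Es // /ratio_at /= mulrC.
apply/matrixP => l i; rewrite !mxE -/(rho i); have [->|ni] := eqVneq i i0.
  by rewrite ratio_at_diag // divff ?xvar_neq0.
by rewrite Es.
Qed.

Hypothesis hk : [pchar k] =i pred0.

(** [zero_locus_ratio] applied to the relations [transport], with [a] and [b] the
    numerator and denominator of [f] at the point w_i / w_i0 transported by tau.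
    Where [offdiag] vanishes, both [a] and [b] are zero; elsewhere the point is in
    the orbit of the generic point and a = f b by invariance. *)
Lemma invariant_rational f :
  weight0 f -> self_reciprocal f -> multisymmetric f -> RO f.
Proof.
move=> f_w f_r f_s.
pose p := \n_(repr f); pose q := \d_(repr f).
have Ef : f = tofrac p / tofrac q by apply: frac_numden.
have nzq : q != 0 by apply: denom_ratioP.
pose idT : T := finfun id.
(* The fraction need not be reduced, so q may vanish at the point w_i / w_i0; a
   constant scaling moves this point off the zeros of q. *)
have [c nzc nzYq] : exists2 c : 'I_m -> k, (forall l, c l != 0) &
    ev (scaled (fun l => ratC m n (c l)) (based_point idT)) q != 0.
  apply: (exists_scaling_neq0 (c := fun l => xvar k l i0) hk).
  rewrite (_ : scaled _ _ = xmat k m n) ?evalp_xmat ?tofrac_eq0 //.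
  apply/matrixP => l i; rewrite !mxE ffunE /ratio_at /= mulrCA divff ?mulr1 //.
  exact: xvar_neq0.
pose Y (tau : T) := scaled (fun l => ratC m n (c l)) (based_point tau).
pose a tau := offdiag tau * ev (Y tau) p.
pose b tau := offdiag tau * ev (Y tau) q.
pose good (tau : T) := [forall ij, transport ij tau == 0].
have good_ab tau : good tau -> a tau = f * b tau.
  move=> /forallP g; rewrite /a /b; have [->|nzo] := eqVneq (offdiag tau) 0.
    by rewrite !mul0r mulr0.
  have [ij|e [s [d Yd]]] := @consistent_symmetry tau _ nzo; first exact/eqP.
  rewrite mulrCA; congr (_ * _).
  rewrite (_ : Y tau = scaled (fun l => ratC m n (c l) * d l) (signed_perm k m e s)).
    exact: (invariant_numden f_w f_r f_s hk).
  by rewrite /Y Yd; apply/matrixP => l j; rewrite !mxE mulrA.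
have good_id : good idT by apply/forallP => ij; rewrite transport_id.
have b_id : b idT != 0 by exact: mulf_neq0 offdiag_id nzYq.
have subL := rational_subfield k m n.
have hK : [pchar K] =i pred0 by move=> j; rewrite (fmorph_pchar (@ratC k m n)).
have nzr := @ratio_at_neq0 k m n.
have Lr l x : laurent (fun tau : T => ratio_at l (tau x)) by apply: laurent_ratio.
have Ltr ij : laurent (transport ij).
  apply: LaurentD (fun=> erefl); first exact: laurentM (fun=> erefl).
  exact: laurentN.
have Lev P : laurent (fun tau => ev (Y tau) P).
  apply: (laurent_mmap subL nzr (y := fun t tau => mxvec (Y tau) ord0 t)).
    exact: rational_const.
  case/mxvec_indexP=> l i.
  apply: (laurentM subL nzr (laurent_const _ _ (rational_const m n (c l))) (Lr l (i, i0))).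
  by move=> tau; rewrite /= mxvecE !mxE.
have Loff : laurent offdiag.
  apply: laurent_prod => // ij; apply: LaurentD (Lr l0 ij) _ (fun=> erefl).
  exact: (laurentN subL nzr (laurent_const _ _ (subfield1 subL))).
have La : laurent a by apply: laurentM (fun=> erefl).
have Lb : laurent b by apply: laurentM (fun=> erefl).
apply: (zero_locus_ratio subL hK nzr _ Ltr La Lb good_ab good_id b_id) => r.
by rewrite -observableE; apply/rational_polynomial/polynomial_observable.
Qed.

End Reconstruction.

Section EfunInvariance.
Variables (k : fieldType) (m n : nat).
Local Notation K := (ratfun k m n).

Lemma Efun_xmat : Efun_at (xmat k m n) = Efun k m n.
Proof.
apply: eq_bigr => j _; apply: eq_bigr => js _.
have E (t : 'I_m -> 'I_n) : \prod_l xmat k m n l (t l) = \prod_l xvar k l (t l).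
  by apply: eq_bigr => l _; rewrite mxE.
by rewrite (E js) (E (fun=> j)).
Qed.

Lemma Efun_ratsubst (V : 'M[K]_(m, n)) : alg_independent V ->
  (forall l j, V l j != 0) -> ratsubst V (Efun k m n) = Efun_at V.
Proof. by move=> ndV nzV; apply: ratsubst_eq => //; apply: specializes_Efun. Qed.

Lemma Efun_weight0 : weight0 (Efun k m n).
Proof.
move=> c nzc; have nzC l : ratC m n (c l) != 0 by rewrite fmorph_eq0.
rewrite -[RHS]Efun_xmat -(Efun_at_scale _ nzC).
have -> : \matrix_(l, j) (ratC m n (c l) * xvar k l j) =
    scaled (fun l => ratC m n (c l)) (signed_perm k m false (1 : {perm 'I_n})%g).
  by apply/matrixP => l j; rewrite !mxE perm1.
rewrite Efun_ratsubst; last 1 first.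
- by move=> l j; rewrite !mxE mulf_neq0 ?xvar_neq0.
- by congr Efun_at; apply/matrixP => l j; rewrite !mxE perm1.
exact: signed_perm_alg_independent.
Qed.

Lemma Efun_self_reciprocal : self_reciprocal (Efun k m n).
Proof.
rewrite /self_reciprocal -[RHS]Efun_xmat -Efun_at_inv.
have -> : \matrix_(l, j) (xvar k l j)^-1 = signed_perm k m true (1 : {perm 'I_n})%g.
  by apply/matrixP => l j; rewrite !mxE perm1.
rewrite Efun_ratsubst; last 1 first.
- by move=> l j; rewrite !mxE invr_eq0 xvar_neq0.
- by congr Efun_at; apply/matrixP => l j; rewrite !mxE perm1.
by rewrite -[signed_perm _ _ _ _]scaled1; apply: signed_perm_alg_independent => l; apply: oner_neq0.
Qed.

Lemma Efun_multisymmetric : multisymmetric (Efun k m n).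
Proof.
move=> s; rewrite -[RHS]Efun_xmat -(Efun_at_perm _ s).
have -> : \matrix_(l, j) xvar k l (s j) = signed_perm k m false s.
  by apply/matrixP => l j; rewrite !mxE.
rewrite Efun_ratsubst; last 1 first.
- by move=> l j; rewrite !mxE xvar_neq0.
- by congr Efun_at; apply/matrixP => l j; rewrite !mxE.
by rewrite -[signed_perm _ _ _ _]scaled1; apply: signed_perm_alg_independent => l; apply: oner_neq0.
Qed.

End EfunInvariance.

(** * Two configurations with the same observables *)

(** Induction on the size: a reducible polynomial has a smaller nonconstant
    divisor. *)
Lemma irreducible_factor (F : fieldType) (p : {poly F}) : (1 < size p)%N ->
  exists2 d, irreducible_poly d & d %| p.
Proof.
have [N] := ubnP (size p); elim: N p => // N IH p; rewrite ltnS => le_pN gt1p.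
have [irr|red] := classic (irreducible_poly p); first by exists p; rewrite ?dvdpp.
have [d [nd d_p ne_dp]] : exists d : {poly F}, [/\ size d != 1%N, d %| p & ~~ (d %= p)].
  apply: NNPP => none; case: red; split=> // d nd d_p.
  by apply: contraT => ne; case: none; exists d.
have nzp : p != 0 by rewrite -size_poly_gt0; apply: ltnW.
have nzd : d != 0 by apply: contraNneq nzp => d0; rewrite -dvd0p -d0.
have lt_dp : (size d < size p)%N.
  by rewrite ltn_neqAle dvdp_leq // andbT; move: ne_dp; rewrite -dvdp_size_eqp.
have [||e irr_e e_d] := IH d.
- exact: leq_trans lt_dp _.
- by rewrite ltn_neqAle eq_sym nd size_poly_gt0.
by exists e => //; apply: dvdp_trans d_p.
Qed.

Lemma root_extension (F : fieldType) (p : {poly F}) : (1 < size p)%N ->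
  exists (L : fieldType) (io : {rmorphism F -> L}) (z : L), root (map_poly io p) z.
Proof.
move=> /irreducible_factor [d irr_d d_p].
have [L _ [z rz _]] := irredp_FAdjoin irr_d.
exists L, (GRing.in_alg L), z.
by apply: root_dvdp rz; rewrite dvdp_map.
Qed.

(** For even N any root of X^N + 1 will do, since z^2 = 1 would give z^N = 1.  For
    odd N the root -1 must be excluded: z = - w with w^N = 1 and w <> 1, where w is
    a root of 1 + X + ... + X^(N-1), whose value at 1 is N. *)
Lemma antiperiodic_root (k : fieldType) (hk : [pchar k] =i pred0) (N : nat) :
  (2 <= N)%N -> exists (L : fieldType) (io : {rmorphism k -> L}) (z : L),
    z ^+ N = -1 /\ z ^+ 2 != 1.
Proof.
move=> geN2; have [odd_N|even_N] := boolP (odd N).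
  pose p : {poly k} := \poly_(i < N) 1.
  have sp : size p = N by rewrite size_poly_eq ?oner_neq0.
  have [|L [io [w rw]]] := root_extension (p := p); first by rewrite sp.
  have wE : \sum_(i < N) w ^+ i = 0.
    move/rootP: rw; rewrite horner_coef size_map_poly sp => E; rewrite -[RHS]E.
    by apply: eq_bigr => i _; rewrite coef_map /= coef_poly ltn_ord rmorph1 mul1r.
  have w1 : w != 1.
    apply: contra_eqN wE => /eqP ->; under eq_bigr do rewrite expr1n.
    rewrite sumr_const card_ord natr_neq0 //; last by lia.
    by move=> j; rewrite (fmorph_pchar io).
  have wN : w ^+ N = 1 by apply/eqP; rewrite -subr_eq0 subrX1 wE mulr0.
  exists L, io, (- w); split; first by rewrite exprNn wN -signr_odd odd_N mulr1 expr1.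
  rewrite sqrrN; apply: contra_neq w1 => w2.
  by rewrite -wN -[N in RHS]odd_double_half odd_N exprD -muln2 mulnC exprM w2 expr1n mulr1 expr1.
have [|L [io [z rz]]] := root_extension (p := 'X^N + 1 : {poly k}).
  by rewrite size_XnaddC //; lia.
exists L, io, z.
have zN : z ^+ N = -1.
  move/rootP: rz; rewrite rmorphD rmorphXn /= map_polyX rmorph1 !hornerE.
  by move/eqP; rewrite addr_eq0 => /eqP.
split=> //; apply/eqP => z2; move: zN.
rewrite -[N]odd_double_half (negPf even_N) add0n -muln2 mulnC exprM z2 expr1n => /eqP.
rewrite -subr_eq0 opprK (_ : 1 + 1 = 2%:R) // (negPf (natr_neq0 _ _)) //.
by move=> j; rewrite (fmorph_pchar io).
Qed.

Section Homometric.
Variables (L : fieldType) (hL : [pchar L] =i pred0) (m N : nat) (z : L).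
Hypotheses (geN2 : (2 <= N)%N) (zN : z ^+ N = -1) (z2 : z ^+ 2 != 1).
Local Notation n := N.+2.

(** Values of a character on the configuration: x is its value at the generator of
    the subgroup, s its value at the offset b.  The second block is b x^e, b x^(e+1),
    so e = 0 and e = 1 give the two configurations. *)
Definition entry (x s : L) (e j : nat) : L :=
  if (j < N)%N then x ^+ j.*2 else s * x ^+ (e + (j == N.+1)).

Definition geom (x : L) : L := \sum_(j < N) x ^+ j.*2.

Lemma sum_entry x s e : \sum_(j < n) entry x s e j = geom x + s * x ^+ e * (1 + x).
Proof.
rewrite 2!big_ord_recr /= /entry ltnn (ltnNge N.+1) leqnSn eqxx /=.
rewrite (_ : (N == N.+1) = false) ?addn0 ?addn1; last by lia.
rewrite exprSr -addrA; congr (_ + _); last by ring.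
by apply: eq_bigr => j _; rewrite ltn_ord.
Qed.

Lemma entryM x y s t e j : entry (x * y) (s * t) e j = entry x s e j * entry y t e j.
Proof. by rewrite /entry; case: ifP => _; rewrite exprMn // mulrACA. Qed.

Lemma entry1 e j : entry 1 1 e j = 1.
Proof. by rewrite /entry !expr1n mulr1 if_same. Qed.

Lemma entryV x s e j : (entry x s e j)^-1 = entry x^-1 s^-1 e j.
Proof. by rewrite /entry; case: ifP => _; rewrite ?invfM exprVn. Qed.

Lemma entryX x s e j r : entry x s e j ^+ r = entry (x ^+ r) (s ^+ r) e j.
Proof. by elim: r => [|r IH]; rewrite ?entry1 // !exprS entryM IH. Qed.

Lemma entryXz x s e j (r : int) : entry x s e j ^ r = entry (x ^ r) (s ^ r) e j.
Proof.
case: r => r; first exact: entryX.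
by rewrite !NegzE -!exprz_inv -!exprnP -entryX entryV.
Qed.

Lemma entry_prod I (r : seq I) (x s : I -> L) e j :
  \prod_(i <- r) entry (x i) (s i) e j = entry (\prod_(i <- r) x i) (\prod_(i <- r) s i) e j.
Proof.
apply: (big_rec3 (fun a b c => a = entry b c e j)); first by rewrite entry1.
by move=> i a b c _ ->; rewrite entryM.
Qed.

Lemma geom1 : geom 1 = N%:R.
Proof. by rewrite /geom; under eq_bigr do rewrite expr1n; rewrite sumr_const card_ord. Qed.

Lemma geomN1 : geom (-1) = N%:R.
Proof.
rewrite -geom1; apply: eq_bigr => j _.
by rewrite -signr_odd odd_double expr1n.
Qed.

Lemma geom0 x : x ^+ N.*2 = 1 -> x ^+ 2 != 1 -> geom x = 0.
Proof.
move=> x2N x2; have nz : x ^+ 2 - 1 != 0 by rewrite subr_eq0.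
apply: (mulfI nz); rewrite mulr0.
transitivity ((x ^+ 2) ^+ N - 1); last by rewrite -exprM mulnC muln2 x2N subrr.
rewrite [RHS]subrX1; congr (_ * _); apply: eq_bigr => j _.
by rewrite -exprM mulnC muln2.
Qed.

(** If x^2 <> 1 then the first block sums to 0, and the factors x and x^-1 gained by
    the second block cancel; if x = -1 then the second block sums to 0; if x = 1 then
    the two configurations have the same entries. *)
Lemma homometric (x s : L) : x != 0 -> s != 0 -> x ^+ N.*2 = 1 ->
  (\sum_(j < n) entry x s 0 j) * (\sum_(j < n) (entry x s 0 j)^-1)
  = (\sum_(j < n) entry x s 1 j) * (\sum_(j < n) (entry x s 1 j)^-1).
Proof.
move=> nzx nzs x2N.
have V e : \sum_(j < n) (entry x s e j)^-1 = \sum_(j < n) entry x^-1 s^-1 e j.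
  by apply: eq_bigr => j _; rewrite entryV.
rewrite !V !sum_entry !expr1 !expr0.
have [|x2] := eqVneq (x ^+ 2) 1.
  by move/eqP; rewrite sqrf_eq1 => /orP [] /eqP ->; rewrite ?invr1 ?invrN1; ring.
rewrite !geom0 //; first by field; rewrite ?nzx ?nzs.
- by rewrite exprVn x2N invr1.
by rewrite exprVn; apply: contraNneq x2 => E; rewrite -[_ ^+ 2]invrK E invr1.
Qed.

(** Exponents of the one-parameter subgroup.  Passing from e = 0 to e = 1 multiplies
    the power sum of a character with value x by x if x^2 <> 1, but leaves it
    unchanged if x = -1 or x = 1.  Since the first two exponents add up to N and
    z^N = -1, the sums over the first two rows gain the factor z z^(N-1) = -1, while
    the power sum of the character (1, ..., 1) stays the same. *)
Definition wt (l : 'I_m.+2) : nat := nth 0%N [:: 1%N; N.-1] l.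
(** The offset b; with b = 1 the two halves of E_m would cancel. *)
Definition scal (l : 'I_m.+2) : L := if l == ord0 then 2%:R else 1.

Definition config (e : nat) : 'M[L]_(m.+2, n) :=
  \matrix_(l, j) entry (z ^+ wt l) (scal l) e j.

Let two_neq0 : 2%:R != 0 :> L. Proof. exact: natr_neq0. Qed.

Let z_neq0 : z != 0.
Proof.
apply/eqP => z0; move/eqP: zN; rewrite z0 expr0n (_ : (N == 0)%N = false); last by lia.
by rewrite eq_sym oppr_eq0 oner_eq0.
Qed.

Let scal_neq0 l : scal l != 0.
Proof. by rewrite /scal; case: ifP; rewrite ?oner_neq0. Qed.

Lemma config_neq0 e l j : config e l j != 0.
Proof.
rewrite mxE /entry; case: ifP => _; first by rewrite !expf_neq0.
by rewrite mulf_neq0 ?expf_neq0.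
Qed.

Lemma config_observables r : observable_at (config 0) r = observable_at (config 1) r.
Proof.
pose x := \prod_(l < m.+2) (z ^+ wt l) ^ r l.
pose s := \prod_(l < m.+2) scal l ^ r l.
have M e j : monom (config e) r j = entry x s e j.
  by rewrite -entry_prod; apply: eq_bigr => l _; rewrite mxE entryXz.
have S e : powsum (config e) r = \sum_(j < n) entry x s e j by apply: eq_bigr.
have S' e : \sum_(j < n) (monom (config e) r j)^-1 = \sum_(j < n) (entry x s e j)^-1.
  by apply: eq_bigr => j _; rewrite M.
rewrite !observable_at_powsum !S !S'.
apply: homometric; first by apply/prodf_neq0 => l _; rewrite expfz_neq0 ?expf_neq0.
  by apply/prodf_neq0 => l _; rewrite expfz_neq0.
rewrite /x -prodrXl big1 // => l _.
rewrite exprnP -exprzAC -exprnP -exprM mulnC exprM -muln2 exprM zN.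
by rewrite sqrrN !expr1n exp1rz.
Qed.

(** The first two rows carry the sign; each further row consists of ones, and the
    character (1, ..., 1) contributes N, as its second block sums to 0. *)
Lemma config_Efun e : Efun_at (config e) =
  N%:R * n%:R ^+ m * (2%:R * (-1) ^+ e * (z - z^-1) + 2%:R^-1 * (-1) ^+ e * (z^-1 - z)).
Proof.
have zN1 : z ^+ N.-1 = - z^-1.
  by apply: (mulfI z_neq0); rewrite -exprS prednK ?zN ?mulrN ?divff //; lia.
have prodz : \prod_(l < m.+2) z ^+ wt l = -1.
  rewrite 2!big_ord_recl big1 => [|l _]; last by rewrite /wt /= nth_nil expr0.
  by rewrite /wt /= zN1 expr1 mulr1 mulrN divff.
have prods : \prod_(l < m.+2) scal l = 2%:R.
  by rewrite 2!big_ord_recl big1 ?mulr1.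
have row x s : \sum_(j < n) \prod_(l < m.+2) entry (x l) (s l) e j
    = geom (\prod_l x l) + (\prod_l s l) * (\prod_l x l) ^+ e * (1 + \prod_l x l).
  by rewrite -sum_entry; apply: eq_bigr => j _; rewrite entry_prod.
have g0 x : x ^+ N = -1 -> x ^+ 2 != 1 -> geom x = 0.
  by move=> xN x2; rewrite geom0 // -muln2 exprM xN sqrrN expr1n.
have sum1 l : \sum_(j < n) config e l j
    = geom (z ^+ wt l) + scal l * (z ^+ wt l) ^+ e * (1 + z ^+ wt l).
  by rewrite -sum_entry; apply: eq_bigr => j _; rewrite mxE.
have sum2 l : \sum_(j < n) (config e l j)^-1
    = geom (z ^- wt l) + (scal l)^-1 * (z ^- wt l) ^+ e * (1 + z ^- wt l).
  by rewrite -sum_entry; apply: eq_bigr => j _; rewrite mxE entryV.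
have zV2 : z^-1 ^+ 2 != 1.
  by rewrite exprVn; apply: contraNneq z2 => E; rewrite -[_ ^+ 2]invrK E invr1.
have gz : geom z = 0.
  by apply: geom0 => //; rewrite -muln2 exprM zN sqrrN expr1n.
have gzV : geom z^-1 = 0.
  by apply: geom0 => //; rewrite exprVn -muln2 exprM zN sqrrN expr1n invr1.
have gN x : geom (- x) = geom x.
  by apply: eq_bigr => j _; rewrite exprNn -signr_odd odd_double mul1r.
have sumC : geom 1 + 1 * 1 ^+ e * (1 + 1) = n%:R.
  by rewrite geom1 expr1n !mul1r -[1 + 1]/(2%:R) -natrD addn2.
have E1 : \prod_(l < m.+2) \sum_(j < n) config e l j =
    n%:R ^+ m * (2%:R * (-1) ^+ e * (z - z^-1)).
  rewrite 2!big_ord_recl !sum1 (eq_bigr (fun=> n%:R)) => [|l _]; last first.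
    by rewrite sum1 /wt /scal /= nth_nil expr0 sumC.
  rewrite prodr_const card_ord /wt /scal /= zN1 expr1 gN gz gzV.
  have -> : (-1) ^+ e = z ^+ e * (- z^-1) ^+ e.
    by rewrite -exprMn mulrN divff.
  by field; rewrite z_neq0.
have E2 : \prod_(l < m.+2) \sum_(j < n) (config e l j)^-1 =
    n%:R ^+ m * (2%:R^-1 * (-1) ^+ e * (z^-1 - z)).
  rewrite 2!big_ord_recl !sum2 (eq_bigr (fun=> n%:R)) => [|l _]; last first.
    by rewrite sum2 /wt /scal /= nth_nil expr0 !invr1 sumC.
  rewrite prodr_const card_ord /wt /scal /= zN1 expr1 invrN invrK gN gz gzV.
  have -> : (-1) ^+ e = z^-1 ^+ e * (- z) ^+ e.
    by rewrite -exprMn mulrN mulVf.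
  by field; rewrite z_neq0 two_neq0 oner_neq0.
have E3 : \sum_(j < n) \prod_(l < m.+2) config e l j = N%:R.
  under eq_bigr do under eq_bigr do rewrite mxE.
  by rewrite row prodz geomN1 subrr mulr0 addr0.
have E4 : \sum_(j < n) (\prod_(l < m.+2) config e l j)^-1 = N%:R.
  under eq_bigr do under eq_bigr do rewrite mxE.
  under eq_bigr do rewrite -prodfV; under eq_bigr do under eq_bigr do rewrite entryV.
  by rewrite row prodfV prodz invrN1 geomN1 subrr mulr0 addr0.
rewrite Efun_at_powsum E1 E2 E3 E4; ring.
Qed.

Lemma config_separates : Efun_at (config 0) != Efun_at (config 1).
Proof.
rewrite -subr_eq0 !config_Efun expr0 expr1.
have -> : N%:R * n%:R ^+ m * (2%:R * 1 * (z - z^-1) + 2%:R^-1 * 1 * (z^-1 - z)) -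
  N%:R * n%:R ^+ m * (2%:R * (-1) * (z - z^-1) + 2%:R^-1 * (-1) * (z^-1 - z))
  = N%:R * n%:R ^+ m * 3%:R * z^-1 * (z ^+ 2 - 1) by field; rewrite z_neq0.
rewrite !mulf_neq0 ?invr_neq0 ?expf_neq0 ?natr_neq0 ?subr_eq0 //; lia.
Qed.

End Homometric.

Lemma Efun_not_polynomial (k : fieldType) (hk : [pchar k] =i pred0) (m n : nat) :
  (4 <= n)%N -> (2 <= m)%N -> ~ polynomial_in_observables (Efun k m n).
Proof.
case: n => [|[|N]] // geN2; case: m => [|[|m]] // _ polyE.
have [L [io [z [zN z2]]]] := antiperiodic_root hk (geN2 : (1 < N)%N).
have hL : [pchar L] =i pred0 by move=> j; rewrite (fmorph_pchar io).
have /eqP[] := config_separates hL m geN2 zN z2.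
apply: (polynomial_no_separation io) polyE => [l j|l j|r].
- exact: config_neq0.
- exact: config_neq0.
exact: config_observables.
Qed.

Local Close Scope ring_scope.

Theorem theorem1p3 (k : fieldType) (hk : [pchar k]%R =i pred0)
    (m n : nat) (hm : 0 < m) (hn : 0 < n) :
  ((forall f : ratfun k m n,
      weight0 f -> self_reciprocal f -> multisymmetric f ->
      rational_in_observables f)
   /\ rational_in_observables (Efun k m n))
  /\ (4 <= n -> 2 <= m -> ~ polynomial_in_observables (Efun k m n)).
Proof.
have inv f := @invariant_rational k m n (Ordinal hm) (Ordinal hn) hk f.
split; last exact: Efun_not_polynomial.
split; first exact: inv.
apply: inv; [exact: Efun_weight0 | exact: Efun_self_reciprocal | exact: Efun_multisymmetric].
Qed.
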